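(* Consider the discrete-time linear system $x(k+1)=Ax(k)+Bu(k)$ with the polytopic constraint sets $\mathcal{X}$, $\mathcal{U}$, the gain $K$, the terminal set $\mathcal{X}_f$, the matrices $M$, $P$ and the barrier functions $B_x$, $B_u$, $B_f$ described in the context, and suppose conditions (A1)–(A5) of the context hold. Let the feasible set $\mathcal{X}_N$ (defined in the context) have nonempty interior. For $x\in\mathcal{X}_N^\circ$ let $\tilde{\mathbf u}^*(x)=(\tilde u_0^*(x),\dots,\tilde u_{N-1}^*(x))$ be the minimizer of the barrier function based problem $$\tilde J_N^*(x)=\min_{\mathbf u}\ \sum_{k=0}^{N-1}\big[\ell(x_k,u_k)+\varepsilon B_u(u_k)+\varepsilon B_x(x_k)\big]+x_N^\top P x_N+\varepsilon B_f(x_N)$$ subject to $x_0=x$, $x_{k+1}=Ax_k+Bu_k$ (each barrier term being $+\infty$ outside the interior of its domain). Then the feedback $u(k)=\tilde u_0^*(x(k))$ asymptotically stabilizes the origin of the system under strict satisfaction of all input and state constraints for every initial condition $x(0)\in\mathcal{X}_N^\circ$; i.e., for every $x(0)\in\mathcal{X}_N^\circ$ the closed-loop states and inputs remain strictly inside $\mathcal{X}$ and $\mathcal{U}$ for all $k\ge0$, and the origin is asymptotically stable for the closed loop with $\mathcal{X}_N^\circ$ contained in its region of attraction.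
   Context: System: $x(k+1)=Ax(k)+Bu(k)$, $A\in\mathbb{R}^{n\times n}$, $B\in\mathbb{R}^{n\times m}$, $(A,B)$ stabilizable. Constraint sets are (compact) polytopes $\mathcal{X}=\{x: C_xx\le d_x\}$, $\mathcal{U}=\{u: C_uu\le d_u\}$ with $C_x\in\mathbb{R}^{q_x\times n}$, $C_u\in\mathbb{R}^{q_u\times m}$, and $d_x\in\mathbb{R}^{q_x}$, $d_u\in\mathbb{R}^{q_u}$ having strictly positive entries; $C^i$ denotes the $i$-th row and $d^i$ the $i$-th entry; $S^\circ$, $\partial S$ denote interior and boundary. Stage cost $\ell(x,u)=x^\top Qx+u^\top Ru$ with $Q$ symmetric positive semidefinite, $R$ symmetric positive definite; horizon $N\in\mathbb{N}_{\ge1}$; barrier weight $\varepsilon>0$; predicted states $x_0=x$, $x_{k+1}=Ax_k+Bu_k$. Recentered logarithmic barriers: for a polytope $\{z: Cz\le d\}$ with $d>0$ entrywise, let $\bar B_i(z)=-\ln(-C^iz+d^i)$ and $\bar B=\sum_i\bar B_i$. The gradient recentered barrier is $\bar B(z)-\bar B(0)-\nabla\bar B(0)^\top z$; the weight recentered barrier is $\sum_i(1+w^i)(\bar B_i(z)-\bar B_i(0))$ with a vector $w\ge0$ chosen such that $\sum_i(1+w^i)\nabla\bar B_i(0)=0$. Conditions: $K\in\mathbb{R}^{m\times n}$ is a stabilizing gain ($A_K:=A+BK$ Schur); $\mathcal{X}_K:=\{x\in\mathcal{X}: Kx\in\mathcal{U}\}$ and $B_K(x):=B_x(x)+B_u(Kx)$.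 (A1) $B_x$ and $B_u$ are recentered (gradient or weight recentered) logarithmic barrier functions for $\mathcal{X}$ and $\mathcal{U}$. (A2) There is a symmetric positive semidefinite $M$ with $B_K(x)\le x^\top Mx$ for all $x\in\mathcal{N}$, where $\mathcal{N}\subset\mathcal{X}_K$ is convex and compact with $0\in\mathcal{N}^\circ$. (A3) $P$ is symmetric positive definite and solves $P=A_K^\top PA_K+K^\top RK+Q+\varepsilon M$. (A4) The terminal set $\mathcal{X}_f$ is convex and compact with $0\in\mathcal{X}_f$, $\mathcal{X}_f\subset\mathcal{N}\subset\mathcal{X}_K$, and $A_Kx\in\mathcal{X}_f$ for all $x\in\mathcal{X}_f$. (A5) $B_f:\mathcal{X}_f^\circ\to\mathbb{R}_{\ge0}$ is a recentered barrier function for $\mathcal{X}_f$ (convex, continuously differentiable, $B_f(0)=0$, $B_f(x)\to\infty$ as $x\to\partial\mathcal{X}_f$) and $B_f(A_Kx)-B_f(x)\le0$ for all $x\in\mathcal{X}_f^\circ$. Feasible set: $\mathcal{X}_N=\{x\in\mathcal{X}:\exists\,\mathbf u=(u_0,\dots,u_{N-1})$ with $u_k\in\mathcal{U}$, $x_k\in\mathcal{X}$ for $k=0,\dots,N-1$ and $x_N\in\mathcal{X}_f\}$, where $x_k$ are the predicted states from $x_0=x$. *)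

(* Defs.v *)
From HB Require Import structures.
From mathcomp Require Import all_boot all_order all_algebra.
From mathcomp Require Import all_classical all_reals all_analysis.
From mathcomp Require Import complex.
Set Implicit Arguments. Unset Strict Implicit. Unset Printing Implicit Defensive.
Import Order.TTheory GRing.Theory Num.Theory.
Import numFieldNormedType.Exports.
Local Open Scope classical_set_scope.
Local Open Scope ring_scope.

Section Defs.
Variable R : realType.

Definition qf (n : nat) (P : 'M[R]_n) (x : 'cV[R]_n) : R := (x^T *m P *m x) 0 0.

Definition symmetric (n : nat) (P : 'M[R]_n) : Prop := P^T = P.
Definition psd (n : nat) (P : 'M[R]_n) : Prop :=
  symmetric P /\ forall x : 'cV[R]_n, 0 <= qf P x.
Definition pd (n : nat) (P : 'M[R]_n) : Prop :=
  symmetric P /\ forall x : 'cV[R]_n, x != 0 -> 0 < qf P x.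

Definition schur (n : nat) (A : 'M[R]_n) : Prop :=
  forall z : R[i], root (char_poly (map_mx (real_complex R) A)) z -> `|z| < 1.

(* the polytope {z : C z <= d} and its interior {z : C z < d} (domain of the
   logarithmic barrier) *)
Definition polytope (q n : nat) (C : 'M[R]_(q, n)) (d : 'cV[R]_q) : set 'cV[R]_n :=
  [set z | forall i : 'I_q, (C *m z) i 0 <= d i 0].
Definition polytope_strict (q n : nat) (C : 'M[R]_(q, n)) (d : 'cV[R]_q)
  : set 'cV[R]_n := [set z | forall i : 'I_q, (C *m z) i 0 < d i 0].

Definition barB_i (q n : nat) (C : 'M[R]_(q, n)) (d : 'cV[R]_q) (i : 'I_q)
  (z : 'cV[R]_n) : R := - ln (d i 0 - (C *m z) i 0).
Definition barB (q n : nat) (C : 'M[R]_(q, n)) (d : 'cV[R]_q) (z : 'cV[R]_n) : R :=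
  \sum_(i < q) barB_i C d i z.

Definition grad_barB_i0 (q n : nat) (C : 'M[R]_(q, n)) (d : 'cV[R]_q) (i : 'I_q)
  : 'cV[R]_n := (d i 0)^-1 *: (row i C)^T.
Definition grad_barB0 (q n : nat) (C : 'M[R]_(q, n)) (d : 'cV[R]_q) : 'cV[R]_n :=
  \sum_(i < q) grad_barB_i0 C d i.

Definition grad_rec_barrier (q n : nat) (C : 'M[R]_(q, n)) (d : 'cV[R]_q)
  (z : 'cV[R]_n) : R :=
  barB C d z - barB C d 0 - ((grad_barB0 C d)^T *m z) 0 0.

Definition weight_rec_barrier (q n : nat) (C : 'M[R]_(q, n)) (d : 'cV[R]_q)
  (w : 'cV[R]_q) (z : 'cV[R]_n) : R :=
  \sum_(i < q) (1 + w i 0) * (barB_i C d i z - barB_i C d i 0).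

Definition admissible_weight (q n : nat) (C : 'M[R]_(q, n)) (d : 'cV[R]_q)
  (w : 'cV[R]_q) : Prop :=
  (forall i, 0 <= w i 0) /\ \sum_(i < q) (1 + w i 0) *: grad_barB_i0 C d i = 0.

Definition recentered_log_barrier (q n : nat) (C : 'M[R]_(q, n)) (d : 'cV[R]_q)
  (Bz : 'cV[R]_n -> R) : Prop :=
  (forall z, polytope_strict C d z -> Bz z = grad_rec_barrier C d z) \/
  (exists w, admissible_weight C d w /\
     forall z, polytope_strict C d z -> Bz z = weight_rec_barrier C d w z).

Definition ext (T : Type) (S : set T) (f : T -> R) (z : T) : \bar R :=
  if `[< S z >] then (f z)%:E else +oo%E.

(* continuously differentiable on the open set S: differentiable at every
   point of S, and every directional derivative x |-> 'd f x v is continuous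
   on S (equivalent to continuity of x |-> 'd f x in finite dimension) *)
Definition C1_on (n : nat) (S : set 'cV[R]_n) (f : 'cV[R]_n -> R) : Prop :=
  (forall x, S x -> differentiable f x) /\
  (forall v : 'cV[R]_n, {within S, continuous (fun x => 'd f x v)}).

Definition boundary (n : nat) (S : set 'cV[R]_n) : set 'cV[R]_n :=
  closure S `\` interior S.

Definition recentered_barrier (n : nat) (Xf : set 'cV[R]_n) (Bf : 'cV[R]_n -> R)
  : Prop :=
  [/\ interior Xf 0 /\ Bf 0 = 0,
      (forall x, interior Xf x -> 0 <= Bf x),
      convex_function (interior Xf) Bf,
      C1_on (interior Xf) Bf &
      forall xb, boundary Xf xb ->
        forall M : R, exists2 e : R, 0 < e &
          forall y, interior Xf y -> ball xb e y -> M < Bf y].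

Fixpoint pred_state (n m : nat) (A : 'M[R]_n) (B : 'M[R]_(n, m)) (x : 'cV[R]_n)
  (u : nat -> 'cV[R]_m) (k : nat) : 'cV[R]_n :=
  match k with
  | 0 => x
  | k'.+1 => A *m pred_state A B x u k' + B *m u k'
  end.

Definition feasible_set (n m N : nat) (A : 'M[R]_n) (B : 'M[R]_(n, m))
  (X : set 'cV[R]_n) (U : set 'cV[R]_m) (Xf : set 'cV[R]_n) : set 'cV[R]_n :=
  [set x | X x /\ exists u : nat -> 'cV[R]_m,
     (forall k, (k < N)%N -> U (u k) /\ X (pred_state A B x u k)) /\
     Xf (pred_state A B x u N)].

Definition barrier_cost (n m qx qu N : nat) (A : 'M[R]_n) (B : 'M[R]_(n, m))
  (Cx : 'M[R]_(qx, n)) (dx : 'cV[R]_qx) (Cu : 'M[R]_(qu, m)) (du : 'cV[R]_qu)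
  (Q : 'M[R]_n) (Rw : 'M[R]_m) (P : 'M[R]_n) (eps : R)
  (Bx : 'cV[R]_n -> R) (Bu : 'cV[R]_m -> R) (Xf : set 'cV[R]_n) (Bf : 'cV[R]_n -> R)
  (x : 'cV[R]_n) (u : nat -> 'cV[R]_m) : \bar R :=
  let xs := pred_state A B x u in
  ((\sum_(k < N)
      ((qf Q (xs k) + qf Rw (u k))%:E
       + eps%:E * ext (polytope_strict Cu du) Bu (u k)
       + eps%:E * ext (polytope_strict Cx dx) Bx (xs k)))
   + (qf P (xs N))%:E + eps%:E * ext (interior Xf) Bf (xs N))%E.

Fixpoint cl_state (n m : nat) (A : 'M[R]_n) (B : 'M[R]_(n, m))
  (ustar : 'cV[R]_n -> nat -> 'cV[R]_m) (x0 : 'cV[R]_n) (k : nat) : 'cV[R]_n :=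
  match k with
  | 0 => x0
  | k'.+1 => let s := cl_state A B ustar x0 k' in A *m s + B *m ustar s 0%N
  end.

End Defs.

(* Main.v *)
(** With [s i = 1 - C i z / d i], both kinds of recentering turn the logarithmic
barrier into [sum_i c i * (s i - 1 - ln (s i))] with [c i >= 1], which is
nonnegative, blows up at the boundary, and can only be small near the origin when
the polytope is bounded.  The interior of the feasible set consists of the states
that admit strictly feasible inputs: dilate the state slightly, take feasible
inputs there and scale back.  A minimizer exists because [exp (- cost)], extended
by [0], is continuous on the compact set of input sequences.  The optimal cost is a
Lyapunov function: appending the terminal controller to a strictly feasible input
sequence does not increase the cost, by (A2), (A3) and (A5), so along the closed
loop the optimal cost drops by at least [eps * Bx x], and it is at most
[x^T P x + eps * Bf x] near the origin. *)

Require Import Defs.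
From HB Require Import structures.
From mathcomp Require Import all_boot all_order all_algebra.
From mathcomp Require Import all_classical all_reals all_analysis.
From mathcomp Require Import complex.
From mathcomp Require Import ring lra.
Import Order.TTheory GRing.Theory Num.Theory.
Import numFieldNormedType.Exports.
Local Open Scope classical_set_scope.
Local Open Scope ring_scope.

Set Implicit Arguments.
Unset Strict Implicit.
Unset Printing Implicit Defensive.

(** * Continuity of matrix maps and scaling in convex sets *)

Lemma near_continuous_at (T U : topologicalType) (f g : T -> U) (x : T) :
  (\forall y \near x, g y = f y) -> {for x, continuous g} -> {for x, continuous f}.
Proof.
move=> gf cg; rewrite /prop_for /continuous_at -(nbhs_singleton gf).
exact: cvg_trans (near_eq_cvg gf) cg.
Qed.

Section MatrixContinuity.
Variable R : realType.

Lemma cvg_mx_entries (T : Type) (F : set_system T) {FF : Filter F} (m n : nat)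
    (f : T -> 'M[R]_(m, n)) (l : 'M[R]_(m, n)) :
  (forall i j, f x i j @[x --> F] --> l i j) -> f x @[x --> F] --> l.
Proof.
move=> fl U [P lP PU].
have FP : \forall x \near F, forall i j, P i j (f x i j).
  by apply: filter_forall => i; apply: filter_forall => j; exact: fl (lP i j).
by apply: filterS FP => x Px; apply: PU.
Qed.

Lemma continuous_sum (T : topologicalType) (I : finType) (f : I -> T -> R) :
  (forall i, continuous (f i)) -> continuous (fun x => \sum_i f i x).
Proof.
by move=> cf; apply: (@continuous_big R _ +%R) => // ; exact: add_continuous.
Qed.

Lemma mulmx_continuous (m n p : nat) (A : 'M[R]_(m, n)) :
  continuous (fun X : 'M[R]_(n, p) => A *m X).
Proof.
suff H i j : continuous (fun X : 'M[R]_(n, p) => (A *m X) i j).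
  by move=> X; apply: (@cvg_mx_entries _ (nbhs X)) => i j; exact: H.
have -> : (fun X : 'M[R]_(n, p) => (A *m X) i j) =
    fun X => \sum_k A i k * X k j by apply/funext => X; rewrite mxE.
apply: (@continuous_sum _ _ (fun k (X : 'M[R]_(n, p)) => A i k * X k j)) => k X.
by apply: continuousM; [exact: cst_continuous|exact: coord_continuous].
Qed.

Lemma qf_continuous (n : nat) (P : 'M[R]_n) : continuous (qf P).
Proof.
have -> : qf P = fun y => \sum_k y k 0 * (P *m y) k 0.
  by apply/funext => y; rewrite /qf -mulmxA mxE; apply: eq_bigr => k _; rewrite mxE.
apply: (@continuous_sum _ _ (fun k (y : 'cV[R]_n) => y k 0 * (P *m y) k 0)) => k x.
apply: continuousM; first exact: coord_continuous.
apply: (@continuous_comp _ _ _ (mulmx P) (fun y : 'cV[R]_n => y k 0)).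
  exact: mulmx_continuous.
exact: coord_continuous.
Qed.

Lemma qf0 (n : nat) (P : 'M[R]_n) : qf P 0 = 0.
Proof. by rewrite /qf mulmx0 mxE. Qed.

(** If [S] contains the ball of radius [r] around 0, each point within [(1 - s) * r] of [s *: z] is
    a convex combination of [z] and a point [w] of that ball. *)
Lemma interior_star (n : nat) (S : set 'cV[R]_n) (s : R) (z : 'cV[R]_n) :
  convex_set S -> interior S 0 -> S z -> 0 <= s < 1 -> interior S (s *: z).
Proof.
move=> cS; rewrite /interior => /nbhs_ballP[r /= r0 rS] Sz /andP[s0 s1].
have t0 : 0 < 1 - s by rewrite subr_gt0.
apply/nbhs_ballP; exists ((1 - s) * r) => /=; first exact: mulr_gt0.
move=> y; rewrite -ball_normE /= => yr.
pose w := (1 - s)^-1 *: (y - s *: z).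
have Sw : S w.
  apply: rS; rewrite -ball_normE /= sub0r normrN normrZ normfV gtr0_norm//.
  by rewrite mulrC ltr_pdivrMr// mulrC distrC.
have -> : y = s *: z + (1 - s) *: w.
  rewrite /w scalerA divff ?gt_eqF// scale1r addrC subrK//.
have := cS z w (Itv01 s0 (ltW s1)) (mem_set Sz) (mem_set Sw).
by move/set_mem.
Qed.

End MatrixContinuity.

(** * Recentered logarithmic barriers *)

Section Barrier.
Variable R : realType.

(** Continuity of [f] extended by [+oo], stated with real values. Off the closure of [S] the last
    clause is vacuous, so only boundary points matter there. *)
Definition blows_up_outside (T : topologicalType) (S : set T) (f : T -> R) : Prop :=
  [/\ open S, forall x, S x -> {for x, continuous f} &
      forall x, ~ S x -> forall M, \forall y \near x, S y -> M < f y].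

Lemma expR_barrier_continuous (T : topologicalType) (S : set T) (f : T -> R) (e : R) :
  0 < e -> blows_up_outside S f ->
  continuous (fun z => if `[< S z >] then expR (- (e * f z)) else 0).
Proof.
move=> e0 [oS cf fS] x; have [Sx|nSx] := pselect (S x).
  apply: (@near_continuous_at _ _ _ (fun y => expR (- (e * f y)))).
    have : nbhs x S by apply: open_nbhs_nbhs.
    by apply: filterS => y Sy; rewrite asboolT.
  apply: continuous_cvg; first exact: continuous_expR.
  by apply: cvgN; apply: cvgM; [exact: cvg_cst|exact: cf].
rewrite /continuous_at asboolF//; apply/cvgrPdist_lt => d d0.
(* The bound [f y > - ln d / e] says exactly that [expR (- (e * f y)) < d]. *)
have := fS x nSx (- ln d / e); apply: filterS => y yS; rewrite sub0r normrN.
case: asboolP => [/yS fy|_]; last by rewrite normr0.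
rewrite gtr0_norm ?expR_gt0// -ltr_ln ?posrE ?expR_gt0// expRK.
by rewrite ltrNl mulrC -ltr_pdivrMr.
Qed.

Definition log_gap (s : R) : R := s - 1 - ln s.

(** With [t = sqrt s], the estimate [ln s = 2 ln t <= 2 (t - 1)] leaves
    [t^2 - 1 - 2 (t - 1) = (t - 1)^2]. *)
Lemma log_gap_ge_sqr (s : R) : 0 < s -> (1 - Num.sqrt s) ^+ 2 <= log_gap s.
Proof.
move=> s0; set t := Num.sqrt s.
have t0 : 0 < t by rewrite sqrtr_gt0.
have -> : s = t ^+ 2 by rewrite sqr_sqrtr ?ltW.
have : ln (1 + (t - 1)) <= t - 1 by apply: le_ln1Dx; lra.
rewrite addrC subrK => lt.
by rewrite /log_gap lnXn// mulr2n; nra.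
Qed.

Lemma log_gap_ge0 (s : R) : 0 < s -> 0 <= log_gap s.
Proof. by move=> s0; exact: le_trans (sqr_ge0 _) (log_gap_ge_sqr s0). Qed.

(** Only [t = sqrt s < 1] matters: then [1 - t < h / 2], hence [1 - s = (1 - t) (1 + t) < h]. *)
Lemma log_gap_lt (s h : R) : 0 < s -> 0 < h ->
  log_gap s < h ^+ 2 / 4 -> 1 - h < s.
Proof.
move=> s0 h0 /(le_lt_trans (log_gap_ge_sqr s0)).
rewrite -{2}(sqr_sqrtr (ltW s0)); set t := Num.sqrt s.
have t0 : 0 < t by rewrite sqrtr_gt0.
have [t1 _|t1 H] := leP 1 t; first by nra.
have : 1 - t < h / 2 by rewrite ltNge; apply/negP => ?; nra.
by move=> ?; nra.
Qed.

Lemma log_gap_continuous (s : R) : 0 < s -> {for s, continuous log_gap}.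
Proof.
move=> s0; apply: cvgB; last exact: continuous_ln.
by apply: cvgB; [exact: cvg_id|exact: cvg_cst].
Qed.

Variables (q n : nat) (C : 'M[R]_(q, n)) (d : 'cV[R]_q).
Hypothesis d_gt0 : forall i, 0 < d i 0.

Definition slack (i : 'I_q) (z : 'cV[R]_n) : R := 1 - (C *m z) i 0 / d i 0.

Lemma slack_gt (h : R) i z : (1 - h < slack i z) = ((C *m z) i 0 < h * d i 0).
Proof. by rewrite /slack ltrD2l ltrN2 ltr_pdivrMr. Qed.

Lemma polytope_strict_slack z :
  polytope_strict C d z <-> forall i, 0 < slack i z.
Proof.
by split=> H i; have := H i; rewrite -{1}(subrr 1) slack_gt mul1r.
Qed.

Lemma slack_continuous i : continuous (slack i).
Proof.
move=> z; apply: (@continuousB _ R _ (fun=> 1) (fun y => (C *m y) i 0 / d i 0)).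
  exact: cst_continuous.
apply: continuousM; last exact: cst_continuous.
apply: (@continuous_comp _ _ _ (mulmx C) (fun y : 'cV[R]_q => y i 0)).
  exact: mulmx_continuous.
exact: coord_continuous.
Qed.

Lemma polytope_strict_open : open (polytope_strict C d).
Proof.
rewrite openE => z /polytope_strict_slack Sz.
have : \forall y \near z, forall i, 0 < slack i y.
  apply: (@filter_forall _ _ _ (nbhs z)) => i.
  apply: (@cvgr_gt _ _ (nbhs z) _ (slack i) (slack i z)) => //.
  exact: slack_continuous.
by apply: filterS => y /polytope_strict_slack.
Qed.

Lemma barB_iB i z : 0 < slack i z ->
  barB_i C d i z - barB_i C d i 0 = - ln (slack i z).
Proof.
move=> s0; rewrite /barB_i.
have -> : (C *m (0 : 'cV[R]_n)) i 0 = 0 by rewrite mulmx0 mxE.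
rewrite subr0.
have -> : d i 0 - (C *m z) i 0 = d i 0 * slack i z.
  by rewrite /slack mulrBr mulr1 mulrCA divff ?mulr1// gt_eqF.
by rewrite lnM ?posrE//; lra.
Qed.

Lemma grad_barB_i0E i (z : 'cV[R]_n) :
  ((grad_barB_i0 C d i)^T *m z) 0 0 = 1 - slack i z.
Proof.
rewrite /grad_barB_i0 linearZ /= trmxK -scalemxAl mxE /slack opprB addrC subrK.
by rewrite -row_mul mxE mulrC.
Qed.

(* Both recenterings cancel the linear part, which leaves the same
   form with [c i = 1] (gradient) or [c i = 1 + w i] (weights). *)
Lemma recentered_log_barrierE (Bz : 'cV[R]_n -> R) :
  recentered_log_barrier C d Bz ->
  exists2 c : 'I_q -> R, forall i, 1 <= c i &
    forall z, polytope_strict C d z -> Bz z = \sum_i c i * log_gap (slack i z).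
Proof.
case=> [BzE|[w [[w_ge0 w_bal] BzE]]].
  exists (fun=> 1) => // z /[dup] zS /polytope_strict_slack s0.
  rewrite BzE// /grad_rec_barrier /barB /grad_barB0.
  rewrite -sumrB linear_sum /= mulmx_suml summxE -sumrB; apply: eq_bigr => i _.
  by rewrite barB_iB// grad_barB_i0E /log_gap; lra.
exists (fun i => 1 + w i 0) => [i|z /[dup] zS /polytope_strict_slack s0].
  by rewrite lerDl.
have : ((\sum_i (1 + w i 0) *: grad_barB_i0 C d i)^T *m z) 0 0 = 0.
  by rewrite w_bal trmx0 mul0mx mxE.
rewrite linear_sum /= mulmx_suml summxE => bal.
rewrite BzE// -[LHS]subr0 -[X in _ - X]bal /weight_rec_barrier -sumrB; apply: eq_bigr => i _.
rewrite barB_iB// linearZ /= -scalemxAl mxE grad_barB_i0E /log_gap; ring.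
Qed.

Variable Bz : 'cV[R]_n -> R.
Hypothesis BzP : recentered_log_barrier C d Bz.

Lemma recentered_log_barrier_ge i z : polytope_strict C d z ->
  log_gap (slack i z) <= Bz z.
Proof.
have [c c1 BE] := recentered_log_barrierE BzP.
move=> /[dup] zS /polytope_strict_slack s0; rewrite BE// (bigD1 i)//=.
have g0 j : 0 <= c j * log_gap (slack j z).
  by rewrite mulr_ge0 ?log_gap_ge0// (le_trans _ (c1 j)).
rewrite ler_wpDr ?sumr_ge0// ler_peMl// log_gap_ge0//.
Qed.

Lemma recentered_log_barrier_ge0 z : polytope_strict C d z -> 0 <= Bz z.
Proof.
have [c c1 BE] := recentered_log_barrierE BzP.
move=> /[dup] zS /polytope_strict_slack s0; rewrite BE//.
by apply: sumr_ge0 => i _; rewrite mulr_ge0 ?log_gap_ge0// (le_trans _ (c1 i)).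
Qed.

Lemma log_barrier_blows_up : blows_up_outside (polytope_strict C d) Bz.
Proof.
split; first exact: polytope_strict_open.
  have [c c1 BE] := recentered_log_barrierE BzP => z zS.
  apply: (@near_continuous_at _ _ _ (fun y => \sum_i c i * log_gap (slack i y))).
    have : nbhs z (polytope_strict C d).
      by apply: open_nbhs_nbhs; split=> //; exact: polytope_strict_open.
    by apply: filterS => y yS; rewrite BE.
  apply: (@cvg_big R _ +%R 0 xpredT _ _ (nbhs z)) => [|i _].
    exact: add_continuous.
  apply: (@continuousM _ _ (fun=> c i) (fun y => log_gap (slack i y))).
    exact: cst_continuous.
  apply: (@continuous_comp _ _ _ (slack i) log_gap); first exact: slack_continuous.
  by apply: log_gap_continuous; apply/polytope_strict_slack: i.
move=> z nzS M.
have [i si] : exists i, slack i z <= 0.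
  apply: contrapT => /forallNP H; apply: nzS; apply/polytope_strict_slack => i.
  by rewrite ltNge; apply/negP/H.
(* A slack in [(0, expR (- 1 - M))] has [- ln s > 1 + M] and [s - 1 > -1], so its gap exceeds
   [M]. *)
have : \forall y \near z, slack i y < expR (- 1 - M).
  apply: (@cvgr_lt _ _ (nbhs z) _ (slack i) (slack i z)); first exact: slack_continuous.
  exact: le_lt_trans si (expR_gt0 _).
apply: filterS => y sy /[dup] yS /polytope_strict_slack /(_ i) s0.
apply: lt_le_trans (recentered_log_barrier_ge i yS).
move: sy; rewrite -ltr_ln ?posrE ?expR_gt0// expRK /log_gap => ?; lra.
Qed.

(* Small barrier values force [C z <= h d], i.e. [z / h] lies in the polytope. *)
Lemma log_barrier_small (e : R) : compact (polytope C d) -> 0 < e ->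
  exists2 c : R, 0 < c &
    forall z, polytope_strict C d z -> Bz z < c -> `|z| < e.
Proof.
move=> /compact_bounded[r [_ rP]] e0.
pose r1 := `|r| + 1.
have r1_gt0 : 0 < r1 by rewrite /r1 ltr_wpDl.
have {}rP z : polytope C d z -> `|z| <= r1.
  by apply: rP; rewrite /r1 (le_lt_trans (ler_norm r))// ltrDl.
(* Chosen so that [z / h] in the polytope gives [|z| <= r1 * h = e / 2]; the threshold [h ^+ 2 / 4]
   below is the one of [log_gap_lt]. *)
pose h := e / (2 * r1).
have h0 : 0 < h by rewrite divr_gt0// mulr_gt0.
exists (h ^+ 2 / 4) => [|z zS Bc]; first by rewrite divr_gt0// exprn_gt0.
have : polytope C d (h^-1 *: z).
  move=> i; rewrite -scalemxAr mxE mulrC ler_pdivrMr// mulrC ltW// -slack_gt.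
  apply: log_gap_lt => //; first by apply/polytope_strict_slack: i.
  exact: le_lt_trans (recentered_log_barrier_ge i zS) Bc.
move/rP; rewrite normrZ normfV gtr0_norm// mulrC ler_pdivrMr// => /le_lt_trans.
apply; have -> : r1 * h = e / 2 by rewrite /h; field; rewrite gt_eqF.
lra.
Qed.

End Barrier.

(** * Feasible input sequences over a finite horizon *)

Section RecedingHorizon.
Variables (R : realType) (n m : nat) (A : 'M[R]_n) (B : 'M[R]_(n, m)).
Implicit Types (x : 'cV[R]_n) (u v : nat -> 'cV[R]_m).

Local Notation next x w := (A *m x + B *m w).
Local Notation shift u := (fun k => u k.+1).

Section Feasible.
Variables (Sx : set 'cV[R]_n) (Su : set 'cV[R]_m) (Sf : set 'cV[R]_n).

(** Peeling off the first input makes dropping it immediate and gives induction on the horizon. The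
    sets are parameters because both the closed constraints and their strict versions are used. *)
Fixpoint feasible (N : nat) x u : Prop :=
  if N is N'.+1 then [/\ Su (u 0%N), Sx x & feasible N' (next x (u 0%N)) (shift u)]
  else Sf x.

Lemma pred_state_shift x u k :
  pred_state A B (next x (u 0%N)) (shift u) k = pred_state A B x u k.+1.
Proof. by elim: k => //= k ->. Qed.

Lemma feasibleP N x u : feasible N x u <->
  (forall k, (k < N)%N -> Su (u k) /\ Sx (pred_state A B x u k)) /\
  Sf (pred_state A B x u N).
Proof.
elim: N x u => [|N IH] x u /=; first by split=> [|[]].
split=> [[Su0 Sx0 /IH[H HN]]|[H HN]].
  rewrite pred_state_shift /= in HN; split=> // -[|k] kN //.
  by have := H k kN; rewrite pred_state_shift.
have [Su0 Sx0] := H 0%N isT; split=> //; apply/IH.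
rewrite pred_state_shift; split=> // k kN.
by rewrite pred_state_shift; exact: H.
Qed.

Lemma eq_feasible N x u v : (forall k, (k < N)%N -> u k = v k) ->
  feasible N x u -> feasible N x v.
Proof.
elim: N x u v => [//|N IH] x u v /= uv [Su0 Sx0 fu].
rewrite -uv//; split=> //; apply: IH fu => k kN; exact: uv.
Qed.

(** The inputs stay fixed while the state moves, so finitely many open conditions on states
    depending continuously on [x] have to persist. *)
Lemma nbhs_feasible N x u : open Sx -> open Sf -> feasible N x u ->
  \forall y \near x, feasible N y u.
Proof.
move=> oSx oSf; elim: N x u => [|N IH] x u /=.
  by move=> Sfx; exact: open_nbhs_nbhs.
move=> [Su0 Sx0 /IH fu].
have cnext : {for x, continuous (fun y => next y (u 0%N))}.
  apply: (@continuousD R _ _ (mulmx A) (fun=> B *m u 0%N)).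
    exact: mulmx_continuous.
  exact: cst_continuous.
have near_Sx : \forall y \near x, Sx y by exact: open_nbhs_nbhs.
have near_fu : \forall y \near x, feasible N (next y (u 0%N)) (shift u).
  exact: cnext fu.
by apply: filterS2 near_Sx near_fu => y.
Qed.

End Feasible.

(** By linearity the whole trajectory scales; with [s < 1] this carries closed constraints to strict
    ones. *)
Lemma feasible_scale (Sx Tx : set 'cV[R]_n) (Su Tu : set 'cV[R]_m)
    (Sf Tf : set 'cV[R]_n) (s : R) N x u :
  (forall z, Sx z -> Tx (s *: z)) -> (forall z, Su z -> Tu (s *: z)) ->
  (forall z, Sf z -> Tf (s *: z)) ->
  feasible Sx Su Sf N x u -> feasible Tx Tu Tf N (s *: x) (fun k => s *: u k).
Proof.
move=> hx hu hf; elim: N x u => [|N IH] x u /=; first exact: hf.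
move=> [Su0 Sx0 fu]; split; [exact: hu|exact: hx|].
by rewrite -!scalemxAr -scalerDr; exact: IH.
Qed.

(** * The cost as a real-valued recursion *)

Variables (Q : 'M[R]_n) (Rw : 'M[R]_m) (P : 'M[R]_n) (eps : R).
Variables (Sx : set 'cV[R]_n) (Su : set 'cV[R]_m) (Sf : set 'cV[R]_n).
Variables (Bx : 'cV[R]_n -> R) (Bu : 'cV[R]_m -> R) (Bf : 'cV[R]_n -> R).

Local Notation sfeasible := (feasible Sx Su Sf).

Definition stage_cost x (w : 'cV[R]_m) : R :=
  qf Q x + qf Rw w + eps * Bu w + eps * Bx x.

Definition terminal_cost x : R := qf P x + eps * Bf x.

Fixpoint total_cost (N : nat) x u : R :=
  if N is N'.+1 then
    stage_cost x (u 0%N) + total_cost N' (next x (u 0%N)) (shift u)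
  else terminal_cost x.

Lemma eq_total_cost N x u v : (forall k, (k < N)%N -> u k = v k) ->
  total_cost N x u = total_cost N x v.
Proof.
elim: N x u v => [//|N IH] x u v /= uv; rewrite uv//; congr (_ + _).
by apply: IH => k kN; exact: uv.
Qed.

Hypothesis eps_gt0 : 0 < eps.

(** No term is [-oo], and [eps > 0] keeps [eps * +oo] infinite, so one violated strict constraint
    makes the whole sum [+oo]. *)
Lemma extended_total_costE N x u :
  (\sum_(k < N)
      ((qf Q (pred_state A B x u k) + qf Rw (u k))%:E
       + eps%:E * ext Su Bu (u k)
       + eps%:E * ext Sx Bx (pred_state A B x u k))
   + (qf P (pred_state A B x u N))%:E
   + eps%:E * ext Sf Bf (pred_state A B x u N))%E =
  (if `[< sfeasible N x u >] then (total_cost N x u)%:E else +oo%E).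
Proof.
elim: N x u => [|N IH] x u.
  rewrite big_ord0 add0e /= /ext; case: asboolP => _.
    by rewrite -EFinM -EFinD.
  by rewrite gt0_muley ?lte_fin.
rewrite big_ord_recl -!addeA.
under eq_bigr => k _ do rewrite lift0 -pred_state_shift.
rewrite -pred_state_shift /=.
have := IH (next x (u 0%N)) (shift u); rewrite -addeA => ->.
rewrite /ext; case: (asboolP (Su _)) => Su0; last first.
  rewrite gt0_muley ?lte_fin// [X in _ = if X then _ else _]asboolF; last by case.
  case: ifP => _; case: ifP => _; by rewrite ?gt0_muley ?lte_fin.
case: (asboolP (Sx _)) => Sx0; last first.
  rewrite [(_ * +oo)%E]gt0_muley ?lte_fin// [X in _ = if X then _ else _]asboolF; last by case.
  by case: ifP.
case: asboolP => fu; last by rewrite [X in _ = if X then _ else _]asboolF//; case.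
rewrite [X in _ = if X then _ else _]asboolT// -!EFinM -!EFinD.
rewrite /stage_cost; congr EFin; ring.
Qed.

Hypothesis Q_psd : psd Q.
Hypothesis Rw_pd : pd Rw.
Hypothesis P_pd : pd P.
Hypothesis Bx_ge0 : forall z, Sx z -> 0 <= Bx z.
Hypothesis Bu_ge0 : forall z, Su z -> 0 <= Bu z.
Hypothesis Bf_ge0 : forall z, Sf z -> 0 <= Bf z.

Lemma pd_qf_ge0 k (M : 'M[R]_k) (z : 'cV[R]_k) : pd M -> 0 <= qf M z.
Proof.
by case=> _ M0; have [->|/M0/ltW//] := eqVneq z 0; rewrite qf0.
Qed.

Lemma stage_cost_ge x (w : 'cV[R]_m) : Su w -> eps * Bx x <= stage_cost x w.
Proof.
move=> /Bu_ge0 Bw; have := pd_qf_ge0 w Rw_pd; have := Q_psd.2 x.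
have := mulr_ge0 (ltW eps_gt0) Bw; rewrite /stage_cost; lra.
Qed.

Lemma total_cost_ge0 N x u : sfeasible N x u -> 0 <= total_cost N x u.
Proof.
elim: N x u => [|N IH] x u /=.
  by move=> /Bf_ge0 Bf0; rewrite addr_ge0 ?pd_qf_ge0// mulr_ge0// ltW.
move=> [Su0 Sx0 /IH c0]; rewrite addr_ge0//.
by apply: le_trans (stage_cost_ge x Su0); rewrite mulr_ge0 ?Bx_ge0// ltW.
Qed.

(** * Existence of minimizers *)

Section Existence.
Hypothesis Bx_barrier : blows_up_outside Sx Bx.
Hypothesis Bu_barrier : blows_up_outside Su Bu.
Hypothesis Bf_barrier : blows_up_outside Sf Bf.

Definition exp_barrier (T : Type) (S : set T) (f : T -> R) (z : T) : R :=
  if `[< S z >] then expR (- (eps * f z)) else 0.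

(* [exp (- total_cost)], extended by [0] outside the feasible inputs: this
   makes it a continuous function, whose maximizers are the minimizers of
   the extended-valued cost. *)
Fixpoint exp_cost (N : nat) x u : R :=
  if N is N'.+1 then
    expR (- (qf Q x + qf Rw (u 0%N))) * exp_barrier Su Bu (u 0%N)
      * exp_barrier Sx Bx x * exp_cost N' (next x (u 0%N)) (shift u)
  else expR (- qf P x) * exp_barrier Sf Bf x.

Lemma exp_costE N x u : exp_cost N x u =
  if `[< sfeasible N x u >] then expR (- total_cost N x u) else 0.
Proof.
elim: N x u => [|N IH] x u /=; rewrite /exp_barrier.
  case: ifP => _; last by rewrite mulr0.
  by rewrite -expRD /terminal_cost opprD.
rewrite IH; case: (asboolP (Su _)) => Su0; last first.
  by rewrite mulr0 !mul0r asboolF//; case.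
case: (asboolP (Sx _)) => Sx0; last by rewrite mulr0 mul0r asboolF//; case.
case: asboolP => fu; last by rewrite mulr0 asboolF//; case.
rewrite asboolT// -!expRD /stage_cost; congr expR; ring.
Qed.

(** The state varies with [t] too: even from a fixed start, the successor state depends on the first
    input, and the induction needs this. *)
Lemma exp_cost_continuous (T : topologicalType) (X : T -> 'cV[R]_n)
    (U : T -> nat -> 'cV[R]_m) N :
  continuous X -> (forall k, continuous (fun t => U t k)) ->
  continuous (fun t => exp_cost N (X t) (U t)).
Proof.
elim: N X U => [|N IH] X U cX cU t /=.
  apply: cvgM.
    apply: continuous_cvg; first exact: continuous_expR.
    by apply: cvgN; apply: continuous_cvg; [exact: qf_continuous|exact: cX].
  apply: continuous_cvg; last exact: cX.
  exact: expR_barrier_continuous.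
apply: cvgM; first apply: cvgM; first apply: cvgM.
- apply: continuous_cvg; first exact: continuous_expR.
  by apply: cvgN; apply: cvgD; apply: continuous_cvg;
    [exact: qf_continuous|exact: cX|exact: qf_continuous|exact: cU].
- apply: continuous_cvg; last exact: cU.
  exact: expR_barrier_continuous.
- apply: continuous_cvg; last exact: cX.
  exact: expR_barrier_continuous.
apply: (IH (fun t => next (X t) (U t 0%N)) (fun t => shift (U t))) => [s|k].
  by apply: cvgD; apply: continuous_cvg;
    [exact: mulmx_continuous|exact: cX|exact: mulmx_continuous|exact: cU].
exact: cU.
Qed.

Lemma exists_minimizer (KU : set 'cV[R]_m) N x :
  compact KU -> KU 0 -> Su `<=` KU -> (exists u, sfeasible N x u) ->
  exists2 u, sfeasible N x u &
    forall v, sfeasible N x v -> total_cost N x u <= total_cost N x v.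
Proof.
move=> cKU KU0 SuKU [u0 fu0].
(* Inputs from [N] on do not affect the cost; setting them to [0], a point of [KU], puts the
   sequence in a product of compact sets. *)
pose trunc u k := if (k < N)%N then u k else 0.
have truncE u k : (k < N)%N -> u k = trunc u k by rewrite /trunc => ->.
pose KUN : set (prod_topology (fun _ : nat => 'cV[R]_m)) :=
  [set u | forall k, KU (u k)].
have trunc_in u : sfeasible N x u -> KUN (trunc u).
  move=> /feasibleP[H _] k; rewrite /trunc; case: ifP => // /H[+ _].
  exact: SuKU.
have cKUN : compact KUN by exact: (@tychonoff nat (fun=> 'cV[R]_m) (fun=> KU)).
pose g (u : prod_topology (fun _ : nat => 'cV[R]_m)) := exp_cost N x u.
have cg : continuous g.
  apply: (@exp_cost_continuous (prod_topology (fun _ : nat => 'cV[R]_m))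
    (fun=> x) (fun u => u) N) => k; first exact: cst_continuous.
  exact: (@proj_continuous nat (fun=> 'cV[R]_m) k).
have [||u _ umax] := @compact_EVT_max _ R g KUN _ cKUN.
- by exists (trunc u0); exact: trunc_in.
- exact: continuous_subspaceT.
have gE v : sfeasible N x v -> g (trunc v) = expR (- total_cost N x v).
  move=> fv; rewrite /g exp_costE -(eq_total_cost _ (truncE v)).
  by rewrite asboolT//; exact: eq_feasible (truncE v) fv.
have le_g v : sfeasible N x v -> expR (- total_cost N x v) <= g u.
  by move=> fv; rewrite -gE//; apply: umax; apply: mem_set; exact: trunc_in.
(* The maximum is at least [expR (- total_cost N x u0) > 0], whereas infeasible inputs have value
   0. *)
have fu : sfeasible N x u.
  apply: contrapT => nfu; have := le_g _ fu0.
  by rewrite /g exp_costE asboolF// leNgt expR_gt0.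
exists u => // v /le_g; rewrite /g exp_costE asboolT// ler_expR lerN2//.
Qed.

End Existence.

(** * Appending the terminal controller *)

Section TerminalController.
Variable K : 'M[R]_(m, n).
Hypothesis terminal_decrease : forall x, Sf x ->
  [/\ Sx x, Su (K *m x), Sf ((A + B *m K) *m x) &
      stage_cost x (K *m x) + terminal_cost ((A + B *m K) *m x) <= terminal_cost x].

(** The induction walks to the end of the horizon, where [K *m x] is appended; the earlier stage
    costs agree on both sides and cancel. *)
Lemma extend_horizon N x u : sfeasible N x u ->
  exists2 v, sfeasible N.+1 x v & total_cost N.+1 x v <= total_cost N x u.
Proof.
elim: N x u => [|N IH] x u.
  move=> /terminal_decrease[Sx0 SuK SfK le]; exists (fun=> K *m x) => /=;
    by rewrite mulmxA -mulmxDl.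
move=> [Su0 Sx0 /IH[v fv le]].
exists (fun k => if k is k'.+1 then v k' else u 0%N); first by split.
by rewrite [leLHS]/= [leRHS]/= lerD2l.
Qed.

(** At horizon 0 the cost is the terminal cost, and each lengthening does not increase it. *)
Lemma terminal_cost_bound N x : Sf x ->
  exists2 u, sfeasible N x u & total_cost N x u <= terminal_cost x.
Proof.
move=> Sfx; elim: N => [|N [u fu le]]; first by exists (fun=> 0).
by have [v fv lev] := extend_horizon fu; exists v => //; exact: le_trans lev le.
Qed.

Lemma shifted_cost N x u : sfeasible N.+1 x u ->
  exists2 v, sfeasible N.+1 (next x (u 0%N)) v &
    total_cost N.+1 (next x (u 0%N)) v <= total_cost N.+1 x u - stage_cost x (u 0%N).
Proof.
move=> [_ _ fu]; have [v fv le] := extend_horizon fu.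
by exists v => //; rewrite [total_cost _ x u]/= addrAC subrr add0r.
Qed.

End TerminalController.

End RecedingHorizon.

(** * Terminal barrier, dilation, Lyapunov equation and a convergence criterion *)

Section TerminalSet.
Variables (R : realType) (n : nat).

Lemma recentered_barrier_blows_up (Xf : set 'cV[R]_n) (Bf : 'cV[R]_n -> R) :
  recentered_barrier Xf Bf -> blows_up_outside (interior Xf) Bf.
Proof.
case=> _ _ _ [dBf _] bBf; split; first exact: open_interior.
  by move=> x /dBf; exact: differentiable_continuous.
move=> x nXf M; have [cx|ncx] := pselect (closure Xf x).
  have [e e0 He] := bBf x (conj cx nXf) M.
  by apply/nbhs_ballP; exists e => //= y xy /He; exact.
have [U [Ux XfU]] : exists U, nbhs x U /\ ~ (Xf `&` U !=set0).
  apply: contrapT => /forallNP H; apply: ncx => U Ux.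
  by apply: contrapT => HU; apply: (H U).
apply: filterS Ux => y Uy /interior_subset Xfy.
by exfalso; apply: XfU; exists y.
Qed.

Lemma dilate_interior (S : set 'cV[R]_n) (x : 'cV[R]_n) : interior S x ->
  exists2 t : R, 1 < t & S (t *: x).
Proof.
rewrite /interior => /nbhs_ballP[r /= r0 rS].
(* This gives [h * |x| <= r / 2]; the [+ 1] covers [x = 0]. *)
pose h := r / (2 * (`|x| + 1)).
have x1 : 0 < `|x| + 1 by rewrite ltr_wpDl.
have h0 : 0 < h by rewrite divr_gt0// mulr_gt0.
exists (1 + h); first by rewrite ltrDl.
apply: rS; rewrite -ball_normE /= scalerDl scale1r opprD addNKr normrN normrZ.
rewrite gtr0_norm//; have hx : h * (`|x| + 1) = r / 2.
  by rewrite /h; field; rewrite gt_eqF.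
have : h * `|x| <= h * (`|x| + 1) by rewrite ler_pM2l// lerDl.
lra.
Qed.

Lemma qf_lyapunov (m : nat) (P Q M : 'M[R]_n) (Rw : 'M[R]_m) (K : 'M[R]_(m, n))
    (AK : 'M[R]_n) (eps : R) (x : 'cV[R]_n) :
  P = AK^T *m P *m AK + K^T *m Rw *m K + Q + eps *: M ->
  qf P x = qf P (AK *m x) + qf Rw (K *m x) + qf Q x + eps * qf M x.
Proof.
move=> PE.
have qfD (S T : 'M[R]_n) : qf (S + T) x = qf S x + qf T x.
  by rewrite /qf mulmxDr mulmxDl mxE.
have qfT k (L : 'M[R]_(k, n)) S : qf (L^T *m S *m L) x = qf S (L *m x).
  by rewrite /qf trmx_mul !mulmxA.
rewrite {1}PE !qfD !qfT; congr (_ + _).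
by rewrite /qf -scalemxAr -scalemxAl mxE.
Qed.

End TerminalSet.

(** [V] is nonincreasing and bounded below, hence convergent, and [b k] is squeezed between 0 and
    [V k - V k.+1]. *)
Lemma summable_decrease_cvg0 (R : realType) (V b : nat -> R) :
  (forall k, 0 <= V k) -> (forall k, 0 <= b k) ->
  (forall k, V k.+1 <= V k - b k) -> b k @[k --> \oo] --> 0.
Proof.
move=> V0 b0 dec.
have /nonincreasing_is_cvgn cV : nonincreasing_seq V.
  apply/nonincreasing_seqP => k; apply: le_trans (dec k) _.
  by rewrite gerBl.
have {}cV : cvgn V by apply: cV; exists 0 => _ [k _ <-].
have cV1 : V k.+1 @[k --> \oo] --> limn V by rewrite cvg_shiftS.
apply: (@squeeze_cvgr _ _ _ _ (fun=> 0) (fun k => V k - V k.+1)).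
- by apply: nearW => k; rewrite b0 /= lerBrDr addrC -lerBrDr.
- exact: cvg_cst.
- by rewrite -[X in _ --> X](subrr (limn V)); apply: cvgB.
Qed.

(** * Asymptotic stability of the closed loop *)

Theorem theorem1 (R : realType) (n m qx qu N : nat)
  (A : 'M[R]_n) (B : 'M[R]_(n, m))
  (Cx : 'M[R]_(qx, n)) (dx : 'cV[R]_qx) (Cu : 'M[R]_(qu, m)) (du : 'cV[R]_qu)
  (Q : 'M[R]_n) (Rw : 'M[R]_m) (eps : R)
  (K : 'M[R]_(m, n)) (M P : 'M[R]_n)
  (Nset Xf : set 'cV[R]_n)
  (Bx : 'cV[R]_n -> R) (Bu : 'cV[R]_m -> R) (Bf : 'cV[R]_n -> R) :
  (* constraint sets: compact polytopes with strictly positive d *)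
  (forall i, 0 < dx i 0) -> (forall i, 0 < du i 0) ->
  compact (polytope Cx dx) -> compact (polytope Cu du) ->
  (* cost, horizon, barrier weight *)
  psd Q -> pd Rw -> (0 < N)%N -> 0 < eps ->
  (* stabilizing gain *)
  schur (A + B *m K) ->
  (* (A1) *)
  recentered_log_barrier Cx dx Bx -> recentered_log_barrier Cu du Bu ->
  (* (A2) *)
  psd M -> convex_set Nset -> compact Nset -> interior Nset 0 ->
  (forall x, Nset x -> polytope Cx dx x /\ polytope Cu du (K *m x)) ->
  (forall x, Nset x ->
     (ext (polytope_strict Cx dx) Bx x + ext (polytope_strict Cu du) Bu (K *m x)
        <= (qf M x)%:E)%E) ->
  (* (A3) *)
  pd P ->
  P = (A + B *m K)^T *m P *m (A + B *m K) + K^T *m Rw *m K + Q + eps *: M ->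
  (* (A4) *)
  convex_set Xf -> compact Xf -> Xf 0 -> Xf `<=` Nset ->
  (forall x, Xf x -> Xf ((A + B *m K) *m x)) ->
  (* (A5) *)
  recentered_barrier Xf Bf ->
  (forall x, interior Xf x ->
     (ext (interior Xf) Bf ((A + B *m K) *m x) <= ext (interior Xf) Bf x)%E) ->
  (* X_N has nonempty interior *)
  let XN := feasible_set N A B (polytope Cx dx) (polytope Cu du) Xf in
  let J := barrier_cost N A B Cx dx Cu du Q Rw P eps Bx Bu Xf Bf in
  interior XN !=set0 ->
  (* the barrier-based problem has a (finite) minimizer on the interior of X_N *)
  (forall x, interior XN x ->
     exists u, (J x u < +oo)%E /\ forall v, (J x u <= J x v)%E) /\
  (* and for any minimizer map ustar, the MPC feedback u(k) = ustar(x(k))_0 ... *)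
  (forall ustar : 'cV[R]_n -> nat -> 'cV[R]_m,
     (forall x, interior XN x -> forall v, (J x (ustar x) <= J x v)%E) ->
     let xcl := cl_state A B ustar in
     (* recursive feasibility and strict constraint satisfaction *)
     (forall x0, interior XN x0 -> forall k,
        [/\ interior XN (xcl x0 k),
            polytope_strict Cx dx (xcl x0 k) &
            polytope_strict Cu du (ustar (xcl x0 k) 0%N)]) /\
     (* Lyapunov stability of the origin *)
     (forall e : R, 0 < e -> exists2 delta : R, 0 < delta &
        forall x0, interior XN x0 -> `|x0| < delta ->
          forall k, `|xcl x0 k| < e) /\
     (* attractivity: X_N interior is contained in the region of attraction *)
     (forall x0, interior XN x0 -> xcl x0 k @[k --> \oo] --> (0 : 'cV[R]_n))).
Proof.
move=> dx0 du0 cX cU Qpsd Rpd N0 e0 _ Bxlog Bulog _ _ _ _ _ Bxu Ppd PE cvxXf _ _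
  XfN _ Bfrec Bfdec XN J _.
set Sx := polytope_strict Cx dx; set Su := polytope_strict Cu du.
set Sf := interior Xf.
have [[Sf0 Bf0] Bf_ge0 _ [dBf _] _] := Bfrec.
have Bx_ge0 z : Sx z -> 0 <= Bx z by exact: recentered_log_barrier_ge0.
have Bu_ge0 z : Su z -> 0 <= Bu z by exact: recentered_log_barrier_ge0.
have Bxb : blows_up_outside Sx Bx by exact: log_barrier_blows_up.
have Bub : blows_up_outside Su Bu by exact: log_barrier_blows_up.
have Bfb : blows_up_outside Sf Bf by exact: recentered_barrier_blows_up.
pose AK := A + B *m K.
pose feas := feasible A B Sx Su Sf.
pose cost := total_cost A B Q Rw P eps Bx Bu Bf.
have JE x u : J x u = if `[< feas N x u >] then (cost N x u)%:E else +oo%E.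
  exact: extended_total_costE.
have J_fin x u : feas N x u -> J x u = (cost N x u)%:E by move=> fu; rewrite JE asboolT.
have J_lty x u : (J x u < +oo)%E -> feas N x u by rewrite JE; case: asboolP.
(* (A3) expands [qf P x], (A2) lets [eps * qf M x] pay for both stage barriers, and (A5) handles
   [Bf]. The right-hand sides in (A2) and (A5) are finite here, which excludes [+oo] on the left and
   yields the strict memberships. *)
have decr x : Sf x -> [/\ Sx x, Su (K *m x), Sf (AK *m x) &
    stage_cost Q Rw eps Bx Bu x (K *m x) + terminal_cost P eps Bf (AK *m x)
      <= terminal_cost P eps Bf x].
  move=> Sfx; have := Bxu x (XfN _ (interior_subset Sfx)).
  rewrite /ext -/Sx -/Su; case: asboolP => // Sxx; case: asboolP => // Sux.
  rewrite -EFinD lee_fin => BM; have := Bfdec x Sfx.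
  rewrite /ext -/Sf -/AK (asboolT Sfx); case: asboolP => // SfAK.
  rewrite lee_fin => Bfle; split=> //.
  rewrite /stage_cost /terminal_cost (qf_lyapunov x PE) -/AK.
  have := ler_wpM2l (ltW e0) BM; have := ler_wpM2l (ltW e0) Bfle.
  by rewrite mulrDr; lra.
have XNE x : interior XN x <-> exists u, feas N x u.
  split=> [/dilate_interior[t t1 [_ [u /feasibleP fu]]]|[u fu]]; last first.
    have [[oSx _ _] [oSf _ _]] := (Bxb, Bfb).
    have := nbhs_feasible oSx oSf fu; rewrite /interior.
    apply: filterS => y fy; have /feasibleP[H HN] := fy.
    (* Membership of [y] in the state polytope is the constraint at stage 0, which is present since
       [N >= 1]. *)
    split; first by have [_ Sxy] := H 0%N N0; move=> i; exact: ltW (Sxy i).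
    exists u; split=> [k kN|]; last exact: interior_subset.
    have [Sk Xk] := H k kN.
    by split=> i; [exact: ltW (Sk i)|exact: ltW (Xk i)].
  have t0 : 0 < t by apply: lt_trans t1.
  have scale_strict q p (C : 'M[R]_(q, p)) (d : 'cV[R]_q) :
      (forall i, 0 < d i 0) ->
      forall z, polytope C d z -> polytope_strict C d (t^-1 *: z).
    move=> d0 z zP i; rewrite -scalemxAr mxE mulrC ltr_pdivrMr//.
    by apply: le_lt_trans (zP i) _; rewrite ltr_pMr.
  exists (fun k => t^-1 *: u k).
  rewrite -[x](scalerK (lt0r_neq0 t0)).
  apply: feasible_scale fu; [exact: scale_strict|exact: scale_strict|].
  move=> z Xfz; apply: interior_star => //.
  by rewrite invr_ge0 ltW//= invf_lt1.
split=> [x /XNE fx|ustar umin xcl].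
  have [||u fu umin] := exists_minimizer Q Rw P e0 Bxb Bub Bfb cU _ _ fx.
  - by move=> i; rewrite mulmx0 mxE ltW.
  - by move=> z zS i; exact: ltW (zS i).
  exists u; split=> [|v]; first by rewrite J_fin// ltry.
  rewrite (J_fin _ _ fu) JE; case: asboolP => [/umin|_]; last exact: leey.
  by rewrite lee_fin.
have ufeas x : interior XN x -> feas N x (ustar x).
  move=> Ix; have /XNE[v fv] := Ix; apply: J_lty.
  by apply: le_lt_trans (umin x Ix v) _; rewrite J_fin// ltry.
have ucost x v : interior XN x -> feas N x v -> cost N x (ustar x) <= cost N x v.
  move=> Ix fv; have := umin x Ix v; rewrite J_fin; last exact: ufeas.
  by rewrite J_fin// lee_fin.
(* Writing the horizon as [N.+1] exposes the first input, the one that is applied and dropped. *)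
case: N N0 @XN @J JE J_fin J_lty XNE umin ufeas ucost => // N _ XN J _ _ _ XNE _ ufeas ucost.
pose V x := cost N.+1 x (ustar x).
have Vge0 x : interior XN x -> 0 <= V x.
  by move=> /ufeas; exact: total_cost_ge0.
(* As [Q] is only semidefinite, the barrier [Bx] supplies the lower bound on [V] that controls the
   norm of the state. *)
have Vge x : interior XN x -> eps * Bx x <= V x.
  move=> /ufeas /= [Su0 _ f']; rewrite /V /cost /=.
  have := stage_cost_ge Bx e0 Qpsd Rpd Bu_ge0 x Su0.
  have := total_cost_ge0 e0 Qpsd Rpd Ppd Bx_ge0 Bu_ge0 Bf_ge0 f'; lra.
have step x : interior XN x -> interior XN (A *m x + B *m ustar x 0%N) /\
    V (A *m x + B *m ustar x 0%N) <= V x - eps * Bx x.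
  move=> /ufeas fx; have [v fv le] := shifted_cost decr fx.
  have Ix' : interior XN (A *m x + B *m ustar x 0%N) by apply/XNE; exists v.
  split=> //; apply: le_trans (ucost _ _ Ix' fv) (le_trans le _).
  by rewrite lerD2l lerN2; case: fx => Su0 _ _; exact: (stage_cost_ge Bx e0 Qpsd Rpd Bu_ge0 x Su0).
have inv x0 k : interior XN x0 -> interior XN (xcl x0 k).
  by move=> I0; elim: k => //= k /step[].
have dec x0 k : interior XN x0 -> V (xcl x0 k.+1) <= V (xcl x0 k) - eps * Bx (xcl x0 k).
  by move=> I0; have /step[] := inv x0 k I0.
have Xin x0 k : interior XN x0 -> Sx (xcl x0 k).
  by move=> I0; have /ufeas[] := inv x0 k I0.
split; [|split].
- move=> x0 I0 k; split; [exact: inv|exact: Xin|].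
  by have /ufeas[] := inv x0 k I0.
(* Near 0 the terminal cost, continuous with value 0 there, bounds [V] by [eps * c]. Since [V] does
   not increase, [Bx < c] persists along the closed loop and confines the state. *)
- move=> e e_gt0; have [c c0 Bsmall] := log_barrier_small dx0 Bxlog cX e_gt0.
  have : \forall x \near (0 : 'cV[R]_n), Sf x /\ terminal_cost P eps Bf x < eps * c.
    apply: filterI.
      by apply: open_nbhs_nbhs; split=> //; exact: open_interior.
    apply: (@cvgr_lt _ _ (nbhs (0 : 'cV[R]_n)) _ (terminal_cost P eps Bf)
      (terminal_cost P eps Bf 0)); last first.
      by rewrite /terminal_cost qf0 Bf0 mulr0 addr0 mulr_gt0.
    apply: (@continuousD _ R _ (qf P) (fun x => eps * Bf x)).
      exact: qf_continuous.
    apply: (@continuousM _ _ (fun=> eps) Bf); first exact: cst_continuous.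
    exact: differentiable_continuous (dBf _ Sf0).
  move=> /nbhs_ballP[delta /= delta0 Hd]; exists delta => // x0 I0 x0d k.
  have [Sfx0 Tx0] : Sf x0 /\ terminal_cost P eps Bf x0 < eps * c.
    by apply: Hd; rewrite -ball_normE /= sub0r normrN.
  have [u fu ule] := terminal_cost_bound decr N.+1 Sfx0.
  have V0 : V x0 < eps * c.
    exact: le_lt_trans (ucost _ _ I0 fu) (le_lt_trans ule Tx0).
  have Vk : V (xcl x0 k) <= V x0.
    elim: k => //= k IH; apply: le_trans (dec x0 k I0) (le_trans _ IH).
    by rewrite gerBl mulr_ge0 ?Bx_ge0 ?ltW//; exact: Xin.
  apply: Bsmall; first exact: Xin.
  rewrite -(ltr_pM2l e0); apply: le_lt_trans (Vge _ (inv x0 k I0)) _.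
  exact: le_lt_trans Vk V0.
move=> x0 I0.
(* The decrements of [V] tend to 0, so [Bx] does along the trajectory, and small barrier values
   force small states. *)
have /cvgrPdist_lt cB : eps * Bx (xcl x0 k) @[k --> \oo] --> 0.
  apply: (@summable_decrease_cvg0 _ (fun k => V (xcl x0 k))) => k.
  - exact: Vge0 (inv x0 k I0).
  - by rewrite mulr_ge0 ?Bx_ge0 ?(ltW e0)//; exact: Xin.
  - exact: dec.
apply/cvgrPdist_lt => e e_gt0.
have [c c0 Bsmall] := log_barrier_small dx0 Bxlog cX e_gt0.
have := cB _ (mulr_gt0 e0 c0); apply: filterS => k.
rewrite !sub0r !normrN => H; apply: Bsmall; first exact: Xin.
by rewrite -(ltr_pM2l e0); apply: le_lt_trans (ler_norm _) H.
Qed.
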